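(* Let $s\in(0,1)$ and let $\Omega\subset\mathbb{R}^n$ be an open set such that $P_s(\Omega)<\infty$. Then for every $E_0\subset\mathbb{R}^n$ there exists a set $E\subset\mathbb{R}^n$ which is $s$-minimal in $\Omega$ and satisfies $E\setminus\Omega=E_0\setminus\Omega$.
   Context: All sets are Lebesgue measurable and are identified up to sets of measure zero. For disjoint $A,B\subset\mathbb{R}^n$ put $\mathcal{L}_s(A,B)=\int_A\int_B\frac{dx\,dy}{|x-y|^{n+s}}\in[0,\infty]$. The $s$-perimeter of $E\subset\mathbb{R}^n$ in an open set $\Omega\subset\mathbb{R}^n$ is, writing $E^c=\mathbb{R}^n\setminus E$, $$P_s(E,\Omega)=\mathcal{L}_s(E\cap\Omega,E^c\cap\Omega)+\mathcal{L}_s(E\cap\Omega,E^c\setminus\Omega)+\mathcal{L}_s(E\setminus\Omega,E^c\cap\Omega),$$ and $P_s(E)=P_s(E,\mathbb{R}^n)$. $E$ is $s$-minimal in $\Omega$ if $P_s(E,\Omega)<\infty$ and $P_s(E,\Omega)\leq P_s(F,\Omega)$ for every $F\subset\mathbb{R}^n$ with $F\setminus\Omega=E\setminus\Omega$. *)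

(* Defs.v *)
From HB Require Import structures.
From mathcomp Require Import all_boot all_order all_algebra.
From mathcomp Require Import all_classical all_reals all_analysis.

Set Implicit Arguments.
Unset Strict Implicit.
Unset Printing Implicit Defensive.
Import Order.TTheory GRing.Theory Num.Theory.
Import numFieldNormedType.Exports.

Local Open Scope classical_set_scope.
Local Open Scope ring_scope.

(* Sigma-algebra generated by the coordinates; for T := R these are the Borel
   sets of R^n. *)
Definition measure_rV_display : measure_display -> measure_display.
Proof. exact. Qed.

Section measurable_rV.
Context d (T : measurableType d) (n : nat).

Definition rV_coord (i : 'I_n) (v : 'rV[T]_n) : T := v ord0 i.

Let rV_set0 : g_sigma_preimage rV_coord set0.
Proof. exact: sigma_algebra0. Qed.

Let rV_setC A : g_sigma_preimage rV_coord A -> g_sigma_preimage rV_coord (~` A).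
Proof. exact: sigma_algebraC. Qed.

Let rV_bigcup (F : _^nat) : (forall i, g_sigma_preimage rV_coord (F i)) ->
  g_sigma_preimage rV_coord (\bigcup_i (F i)).
Proof. exact: sigma_algebra_bigcup. Qed.

HB.instance Definition _ := @isMeasurable.Build (measure_rV_display d)
  'rV[T]_n (g_sigma_preimage rV_coord) rV_set0 rV_setC rV_bigcup.

Lemma measurable_rV_coord (i : 'I_n) : measurable_fun [set: 'rV[T]_n] (rV_coord i).
Proof.
move=> _ Y mY; rewrite setTI; apply: sub_sigma_algebra => /=.
rewrite -bigcup_seq/=; exists i => /=; first by rewrite mem_index_enum.
by exists Y => //; rewrite setTI.
Qed.

Lemma measurable_fun_rV d' (T' : measurableType d') (f : T' -> 'rV[T]_n) :
  (forall i, measurable_fun [set: T'] (fun x => f x ord0 i)) ->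
  measurable_fun [set: T'] f.
Proof.
move=> mf; apply: (@measurability _ _ _ _ _ _
  (\big[setU/set0]_(i < n) preimage_set_system setT (rV_coord i) measurable)) => //.
move=> _ [B + <-]; rewrite -bigcup_seq => -[i _ [C mC <-]].
by rewrite setTI; exact: mf.
Qed.

End measurable_rV.

Section lebesgue_rV.
Context {R : realType}.

(* R^(n+1) is identified with R * R^n through the first coordinate. *)
Definition rV_cons n (p : measurableTypeR R * 'rV[R]_n) : 'rV[R]_n.+1 :=
  row_mx (const_mx p.1 : 'rV_1) p.2.

Definition rV_uncons n (v : 'rV[R]_n.+1) : measurableTypeR R * 'rV[R]_n :=
  (v ord0 ord0, \row_i v ord0 (lift ord0 i)).

Lemma rV_unconsK n : cancel (@rV_uncons n) (@rV_cons n).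
Proof.
move=> v; apply/rowP => i; rewrite /rV_cons /rV_uncons mxE.
case: split_ordP => j ->; rewrite !mxE; congr (v _ _).
  by rewrite ord1; apply: val_inj.
exact: val_inj.
Qed.

Lemma rV_consK n : cancel (@rV_cons n) (@rV_uncons n).
Proof.
move=> [x v]; rewrite /rV_cons /rV_uncons; congr pair.
  by rewrite mxE; case: split_ordP => j // _; rewrite mxE.
apply/rowP => i; rewrite !mxE; case: split_ordP => j; first by rewrite ord1.
by move=> /(congr1 val)[/val_inj ->].
Qed.

Lemma measurable_rV_cons n : measurable_fun setT (@rV_cons n).
Proof.
apply: measurable_fun_rV => i.
have -> : (fun p => rV_cons p ord0 i) =
    match fintype.split (i : 'I_(1 + n)) with
    | inl _ => fst | inr j => rV_coord j \o snd
    end.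
  by apply/funext => p; rewrite mxE; case: fintype.split => // k; rewrite mxE.
case: fintype.split => j; first exact: measurable_fst.
by apply: measurableT_comp; [exact: measurable_rV_coord|exact: measurable_snd].
Qed.

Lemma measurable_rV_uncons n : measurable_fun setT (@rV_uncons n).
Proof.
apply: measurable_fun_pair; first exact: (measurable_rV_coord ord0).
apply: measurable_fun_rV => i.
apply: (eq_measurable_fun (rV_coord (lift ord0 i))) => [v _|].
  by rewrite mxE.
exact: measurable_rV_coord.
Qed.

Section lebesgue_rVS.
Context (n : nat) (mu : {sigma_finite_measure set 'rV[R]_n -> \bar R}).

Definition lebesgue_rVS : set 'rV[R]_n.+1 -> \bar R :=
  pushforward (@lebesgue_measure R \x mu)%E (@rV_cons n).

HB.instance Definition _ := Measure.copy lebesgue_rVS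
  (@measure_function_pushforward__canonical__measure_function_Measure
    _ _ _ _ R _ _ (@measurable_rV_cons n)).

Let lebesgue_rVS_sigma_finite : sigma_finite setT lebesgue_rVS.
Proof.
have /sigma_finiteP[F [TF ndF mF]] := sigma_finiteT (@lebesgue_measure R).
have /sigma_finiteP[G [TG ndG mG]] := sigma_finiteT mu.
exists (fun k => @rV_uncons n @^-1` (F k `*` G k)) => [|k].
  apply/seteqP; split => // v _.
  have [i _ Fi] : (\bigcup_i F i) (rV_uncons v).1 by rewrite -TF.
  have [j _ Gj] : (\bigcup_j G j) (rV_uncons v).2 by rewrite -TG.
  exists (maxn i j) => //; split.
    by move: Fi; exact/subsetPset/ndF/leq_maxl.
  by move: Gj; exact/subsetPset/ndG/leq_maxr.
have [mFk Fkoo] := mF k; have [mGk Gkoo] := mG k; split.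
  rewrite -[X in measurable X]setTI; apply: measurable_rV_uncons => //.
  exact: measurableX.
rewrite /lebesgue_rVS /pushforward -comp_preimage.
rewrite (_ : _ \o _ = id); last by apply/funext => p; exact: rV_consK.
by rewrite preimage_id product_measure1E// lte_mul_pinfty// ge0_fin_numE.
Qed.

HB.instance Definition _ := Measure_isSigmaFinite.Build _ _ _ lebesgue_rVS
  lebesgue_rVS_sigma_finite.

End lebesgue_rVS.

(* Product measure on the Borel sets; on the one-point space R^0 the empty
   product is the unit point mass. *)
Fixpoint borel_lebesgue_rV n : {sigma_finite_measure set 'rV[R]_n -> \bar R} :=
  match n with
  | 0 => \d_(0 : 'rV[R]_0)
  | m.+1 => lebesgue_rVS (borel_lebesgue_rV m)
  end.

Lemma borel_lebesgue_rV_box n (A : 'I_n -> set (measurableTypeR R)) :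
    (forall i, measurable (A i)) ->
  borel_lebesgue_rV n [set v | forall i, A i (v ord0 i)] =
  (\prod_(i < n) lebesgue_measure (A i))%E.
Proof.
elim: n A => [|n IHn] A mA.
  by rewrite big_ord0 /= diracE mem_set// => -[].
have mbox : measurable [set v : 'rV[R]_n | forall i, A (lift ord0 i) (v ord0 i)].
  rewrite (_ : [set v | _] =
      \bigcap_(i in [set: 'I_n]) (@rV_coord _ _ n i @^-1` A (lift ord0 i))).
    apply: fin_bigcap_measurable => // i _.
    by rewrite -[X in measurable X]setTI; apply: measurable_rV_coord => //; exact: mA.
  by apply/seteqP; split => [v Av i _|v Av i]; apply: Av.
rewrite big_ord_recl -(IHn (A \o lift ord0))//= /lebesgue_rVS /pushforward.
rewrite -product_measure1E//; congr product_measure1; apply/seteqP.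
have consE (p : measurableTypeR R * 'rV[R]_n) :
    (rV_cons p ord0 ord0 = p.1) * (forall i, rV_cons p ord0 (lift ord0 i) = p.2 ord0 i).
  have /(congr1 (fun q => q : R * 'rV[R]_n)) := rV_consK p; rewrite /rV_uncons.
  by case: p => x v [-> /rowP vE]; split => // i; rewrite -vE mxE.
split => p /=; first by move=> Ap; split => [|i]; rewrite /= -consE; exact: Ap.
by move=> [A0 AS] i; case: (unliftP ord0 i) => [j|] ->; rewrite consE//; exact: AS.
Qed.

(* The completion: it lives on the Caratheodory sigma-algebra of the outer
   measure, i.e., on the Lebesgue measurable subsets of R^n. *)
Definition lebesgue_rV n := @completed_measure_extension _ _ _ (borel_lebesgue_rV n).
Arguments lebesgue_rV : clear implicits.

HB.instance Definition _ n := Measure.on (lebesgue_rV n).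

Let lebesgue_rV_sigma_finite n : sigma_finite setT (lebesgue_rV n).
Proof. exact/completed_measure_extension_sigma_finite/sigma_finiteT. Qed.

HB.instance Definition _ n := Measure_isSigmaFinite.Build _ _ _ (lebesgue_rV n)
  (@lebesgue_rV_sigma_finite n).

Definition lebesgue_measurable n : set (set 'rV[R]_n) :=
  ((borel_lebesgue_rV n)^*)%mu.-cara.-measurable.

End lebesgue_rV.
Arguments lebesgue_rV {R} n _.

Section fractional_perimeter.
Context {R : realType} {n : nat}.
Implicit Types (s : R) (A B E F Omega : set 'rV[R]_n).

(* The norm provided by the library on 'rV[R]_n is the sup norm. *)
Definition euclidean_norm (v : 'rV[R]_n) : R :=
  Num.sqrt (\sum_(i < n) v ord0 i ^+ 2).

Definition frac_kernel s (x y : 'rV[R]_n) : R :=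
  (euclidean_norm (x - y) `^ (n%:R + s))^-1.

Definition frac_interaction s A B : \bar R :=
  (\int[lebesgue_rV n]_(x in A) \int[lebesgue_rV n]_(y in B)
    (frac_kernel s x y)%:E)%E.

Definition frac_perimeter s E Omega : \bar R :=
  (frac_interaction s (E `&` Omega) (~` E `&` Omega)
   + frac_interaction s (E `&` Omega) (~` E `\` Omega)
   + frac_interaction s (E `\` Omega) (~` E `&` Omega))%E.

Definition ae_eq_set A B : Prop :=
  {ae lebesgue_rV n, forall x, A x <-> B x}.

(* Competitors are Lebesgue measurable sets that agree with E outside Omega up to
   a null set. *)
Definition frac_minimal s Omega E : Prop :=
  (frac_perimeter s E Omega < +oo)%E /\
  forall F, lebesgue_measurable F ->
    ae_eq_set (F `\` Omega) (E `\` Omega) ->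
    (frac_perimeter s E Omega <= frac_perimeter s F Omega)%E.

End fractional_perimeter.

(* Main.v *)
(* No compactness is needed. Put nu(D) = \int_D |x-y|^-(n+s) dx dy, a measure on
   R^n x R^n; then P_s(E, Omega) = nu(D_E), where D_E is the set of pairs (x, y)
   with x in E, y not in E, and x or y in Omega. From
   D_(E `&` F) `|` D_(E `|` F) `<=` D_E `|` D_F and the same with intersections of
   the D's, P_s is submodular. Hence, if P_s(E_k) <= m + 2^-k with m the infimum,
   E_k `&` ... `&` E_(k+l) has P_s at most m + 2 * 2^-k, because every union of
   competitors costs at least m. Pointwise convergence of sets puts D_(lim) inside
   liminf D, so P_s is lower semicontinuous along it; letting first l and then k go
   to infinity, liminf_k E_k is a minimizer. The competitor E0 `|` Omega has
   finite perimeter since its crossing pairs lie in Omega x (complement of Omega). *)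
Require Import Defs.
From HB Require Import structures.
From mathcomp Require Import all_boot all_order all_algebra.
From mathcomp Require Import all_classical all_reals all_analysis.
From mathcomp Require Import measurable_realfun.
From mathcomp Require Import ring lra zify.
Import Order.TTheory GRing.Theory Num.Theory.
Import numFieldNormedType.Exports.
Local Open Scope classical_set_scope.
Local Open Scope ring_scope.

Set Implicit Arguments.
Unset Strict Implicit.
Unset Printing Implicit Defensive.

(** * Pointwise stabilisation of monotone sequences of sets *)

Lemma nonincreasing_near_bigcap T (F : (set T)^nat) x : nonincreasing_seq F ->
  \forall k \near \oo, F k x <-> (\bigcap_k F k) x.
Proof.
move=> niF; have [Fx|/existsNP[N /not_implyP[_ NFx]]] := pselect ((\bigcap_k F k) x).
  by near=> k; split => // _; exact: Fx.
exists N => // k /= Nk; split => [Fkx|]; last exact.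
by have /subsetPset/(_ _ Fkx) := niF _ _ Nk.
Unshelve. all: by end_near. Qed.

Lemma nondecreasing_near_bigcup T (F : (set T)^nat) x : nondecreasing_seq F ->
  \forall k \near \oo, F k x <-> (\bigcup_k F k) x.
Proof.
move=> ndF; have [[N _ FNx]|UFx] := pselect ((\bigcup_k F k) x).
  exists N => // k /= Nk; split => _; first by exists N.
  by have /subsetPset := ndF _ _ Nk; apply.
by near=> k; split => // Fkx; exists k.
Unshelve. all: by end_near. Qed.

(** * Modularity and lower semicontinuity of a measure *)

Section measure_lemmas.
Context d (T : measurableType d) (R : realType) (mu : {measure set T -> \bar R}).
Local Open Scope ereal_scope.

Lemma measure_modular (A B : set T) : measurable A -> measurable B ->
  mu (A `|` B) + mu (A `&` B) = mu A + mu B.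
Proof.
move=> mA mB; have -> : A `|` B = (A `\` B) `|` B.
  by rewrite setDE setUIl setUC [~` B `|` B]setUC setUv setIT setUC.
rewrite measureU//; [|exact: measurableD|by rewrite setDKI].
by rewrite (measureDI mu mA mB) addeAC.
Qed.

(** The tail intersections [G k] increase, lie in [F k], and their union contains [S]; continuity
    from below concludes. *)
Lemma measure_liminf_le (F : (set T)^nat) (S : set T) (c : \bar R) :
  (forall k, measurable (F k)) -> measurable S ->
  (forall x, S x -> \forall k \near \oo, F k x) ->
  (forall k, mu (F k) <= c) -> mu S <= c.
Proof.
move=> mF mS SF Fc; pose G k := \bigcap_(j in [set j | (k <= j)%N]) F j.
have mG k : measurable (G k) by exact: bigcap_measurableType.
have mUG : measurable (\bigcup_k G k) by exact: bigcup_measurable.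
apply: (@le_trans _ _ (mu (\bigcup_k G k))).
  apply: le_measure; rewrite ?inE// => x /SF[N _ NF]; exists N.
have ndG : nondecreasing_seq G.
  by move=> i j ij; apply/subsetPset => x Gx k /= jk; apply: Gx; exact: leq_trans jk.
have cG := nondecreasing_cvg_mu (mu := mu) mG mUG ndG.
rewrite -(cvg_lim _ cG)//; apply: lime_le; first by apply/cvg_ex; eexists; exact: cG.
apply: nearW => k /=; apply: le_trans (Fc k).
by apply: le_measure; rewrite ?inE// => x; apply => /=.
Qed.

End measure_lemmas.

(** * Measures given by a nonnegative density *)

Section density_measure.
Context d (T : measurableType d) (R : realType) (mu : {measure set T -> \bar R}).
Context (f : T -> \bar R).
Local Open Scope ereal_scope.

(** The proofs [mf] and [f0] are arguments so that the measure structure, which depends on them, can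
    be inferred from the term. *)
Definition density_measure (mf : measurable_fun setT f)
  (f0 : forall x, 0 <= f x) (A : set T) := \int[mu]_(x in A) f x.

Hypotheses (mf : measurable_fun setT f) (f0 : forall x, 0 <= f x).

Let nu0 : density_measure mf f0 set0 = 0.
Proof. exact: integral_set0. Qed.

Let nu_ge0 A : 0 <= density_measure mf f0 A.
Proof. exact: integral_ge0. Qed.

HB.instance Definition _ := isMeasure.Build _ _ _ (density_measure mf f0)
  nu0 nu_ge0 (semi_sigma_additive_nng_induced mf f0).

End density_measure.

(** * Abstract perimeters: the measure of the set of crossing pairs *)

Section crossing_functional.
Context d (T : measurableType d) (R : realType).
Context (nu : {measure set (T * T) -> \bar R}) (Omega : set T).
Hypothesis mOmega : measurable Omega.
Local Open Scope ereal_scope.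

Definition crossing (E : set T) : set (T * T) :=
  [set z | [/\ E z.1, ~ E z.2 & Omega z.1 \/ Omega z.2]].

(** The three rectangles carry the three terms of the [s]-perimeter; for measurable [E] they place
    the crossing set in the product sigma-algebra. *)
Lemma crossingE (E : set T) : crossing E =
  ((E `&` Omega) `*` (~` E `&` Omega)) `|` ((E `&` Omega) `*` (~` E `\` Omega))
  `|` ((E `\` Omega) `*` (~` E `&` Omega)).
Proof.
apply/seteqP; split => -[x y] /=; last by move=> [[]|] [[? ?] [? ?]]; split; auto.
move=> [Ex Ey O]; have [Ox|Ox] := pselect (Omega x).
  by left; have [Oy|Oy] := pselect (Omega y); [left|right].
by right; case: O.
Qed.

Lemma measurable_crossing E : measurable E -> measurable (crossing E).
Proof.
move=> mE; have mCE := measurableC mE; rewrite crossingE.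
by apply: measurableU; [apply: measurableU|]; apply: measurableX;
  (exact: measurableI || exact: measurableD).
Qed.

Lemma measure_crossing E : measurable E -> nu (crossing E) =
  nu ((E `&` Omega) `*` (~` E `&` Omega)) +
  nu ((E `&` Omega) `*` (~` E `\` Omega)) +
  nu ((E `\` Omega) `*` (~` E `&` Omega)).
Proof.
move=> mE; have mCE := measurableC mE.
have mEO : measurable (E `&` Omega) by exact: measurableI.
have mEDO : measurable (E `\` Omega) by exact: measurableD.
have mCEO : measurable (~` E `&` Omega) by exact: measurableI.
have mCEDO : measurable (~` E `\` Omega) by exact: measurableD.
rewrite crossingE !measureU//; try by apply: measurableX.
- by apply/seteqP; split => -[x y]//= [[[_ _] [_ ?]] [[_ _] [_]]].
- by apply: measurableU; exact: measurableX.
- by apply/seteqP; split => -[x y]//= [[] [[_ ?] _] [[_ +] _]].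
Qed.

Lemma crossing_submodular E F : measurable E -> measurable F ->
  nu (crossing (E `&` F)) + nu (crossing (E `|` F)) <= nu (crossing E) + nu (crossing F).
Proof.
move=> mE mF; have mcE := measurable_crossing mE; have mcF := measurable_crossing mF.
have mcI : measurable (crossing (E `&` F)) by apply: measurable_crossing; exact: measurableI.
have mcU : measurable (crossing (E `|` F)) by apply: measurable_crossing; exact: measurableU.
rewrite -measure_modular// -[leRHS]measure_modular//; apply: leeD.
  apply: le_measure; rewrite ?inE; try exact: measurableU.
  move=> [x y] [[/= [Ex Fx] /not_andP[]]|[/= Ex /not_orP[]]] *;
    [by left; split|by right; split|by case: Ex; [left|right]; split].
(* A pair in both crossing sets on the left has its first point in [E] and [F] and its second in
   neither, so it crosses both. *)
apply: le_measure; rewrite ?inE; try exact: measurableI.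
by move=> [x y] [[/= [Ex Fx] _ O] [/= _ /not_orP[]]].
Qed.

(** Whether a pair crosses depends on two points only, so eventual agreement at each point
    suffices. *)
Lemma crossing_lsc (E : (set T)^nat) (F : set T) (c : \bar R) :
  (forall k, measurable (E k)) -> measurable F ->
  (forall x, \forall k \near \oo, E k x <-> F x) ->
  (forall k, nu (crossing (E k)) <= c) -> nu (crossing F) <= c.
Proof.
move=> mE mF EF; apply: measure_liminf_le => [k||[x y] [/= Fx Fy O]].
- exact: measurable_crossing.
- exact: measurable_crossing.
- apply: filterS2 (EF x) (EF y) => k Ex Ey.
  by split => //=; [rewrite Ex|rewrite Ey].
Qed.

(** The class [C] of competitors is abstract; its lattice closure serves submodularity, its
    countable closure the passage to the limit. *)
Lemma crossing_minimizer (C : set (set T)) :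
  (forall E, C E -> measurable E) ->
  (exists2 E, C E & nu (crossing E) < +oo) ->
  (forall E F, C E -> C F -> C (E `&` F) /\ C (E `|` F)) ->
  (forall E : (set T)^nat, (forall k, C (E k)) ->
     C (\bigcap_k E k) /\ C (\bigcup_k E k)) ->
  exists2 E, C E & nu (crossing E) < +oo /\ forall F, C F -> nu (crossing E) <= nu (crossing F).
Proof.
move=> Cm [A CA Aoo] CUI Clim.
pose m := ereal_inf [set nu (crossing E) | E in C].
have m_le E : C E -> m <= nu (crossing E) by move=> CE; apply: ereal_inf_lbound; exists E.
have m0 : 0 <= m by apply: le_ereal_inf_tmp => _ [E _ <-].
have mfin : m \is a fin_num by rewrite ge0_fin_numE// (le_lt_trans (m_le _ CA)).
(* Summable excesses over [m], so that the total excess of a tail tends to 0. *)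
have /choice[E_ /all_and2[CE Em]] : forall k : nat, exists E,
    C E /\ nu (crossing E) <= m + (2^-1 ^+ k)%:E.
  move=> k; have e0 : (0 < 2^-1 ^+ k :> R)%R by rewrite exprn_gt0.
  by have [_ [E CE <-] /ltW Em] := lb_ereal_inf_adherent e0 mfin; exists E.
pose G k l := \bigcap_(j < l.+1) E_ (k + j)%N.
have GS k l : G k l.+1 = G k l `&` E_ (k + l.+1)%N.
  by rewrite /G !bigcap_mkord big_ord_recr.
have G0 k : G k 0%N = E_ k by rewrite /G bigcap_mkord big_ord1 addn0.
have CG k l : C (G k l).
  by elim: l => [|l IHl]; [rewrite G0|rewrite GS; case: (CUI _ _ IHl (CE (k + l.+1)%N))].
(* The excess is the geometric sum of [2^-j] for [j] from [k] to [k + l], in closed form. *)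
have Gle k l :
    nu (crossing (G k l)) <= m + (2 * 2^-1 ^+ k - 2^-1 ^+ (k + l))%:E.
  elim: l => [|l IHl].
    by rewrite G0 addn0 mulr_natl mulr2n addrK.
  (* The union is a competitor and costs at least [m]. As [m] is finite, it cancels in the
     submodular inequality, and the intersection gains only the excess of the new set. *)
  have [CI CU] := CUI _ _ (CG k l) (CE (k + l.+1)%N).
  have := crossing_submodular (Cm _ (CG k l)) (Cm _ (CE (k + l.+1)%N)).
  rewrite -GS => /(le_trans (leeD2l _ (m_le _ CU))).
  move=> /le_trans/(_ (leeD IHl (Em _))).
  move=> leGm; rewrite -(leeD2rE _ _ mfin) (le_trans leGm)//.
  rewrite le_eqVlt; apply/orP; left; apply/eqP.
  rewrite addeACA [RHS]addeAC -EFinD addnS exprS; congr (_ + _%:E).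
  by field.
have Gni k : nonincreasing_seq (G k).
  by move=> i j ij; apply/subsetPset => x Gx l /= li; apply: Gx => /=; lia.
pose H k := \bigcap_l G k l.
have CH k : C (H k) by case: (Clim _ (CG k)).
have Hnd : nondecreasing_seq H.
  move=> i j ij; apply/subsetPset => x Hx l _ q /= ql.
  (* [H k] is the intersection of all [E_ p] with [k <= p]; the offset [j - i] locates the tail from
     [j] inside the tail from [i]. *)
  have := Hx (j - i + l)%N I (j - i + q)%N; rewrite addnA subnKC//; apply => /=.
  by move: ql; rewrite /=; lia.
have Hle k : nu (crossing (H k)) <= m + (2 * 2^-1 ^+ k)%:E.
  apply: (@crossing_lsc (G k)) => [l||x|l]; [exact/Cm|exact/Cm| |].
    exact: nonincreasing_near_bigcap.
  apply: le_trans (Gle k l) _; rewrite leeD2l// lee_fin gerBl.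
  by rewrite exprn_ge0.
exists (\bigcup_k H k); first by case: (Clim _ CH).
suff Um : nu (crossing (\bigcup_k H k)) <= m.
  split=> [|F /m_le]; last exact: le_trans.
  by rewrite (le_lt_trans Um)// ltey_eq mfin.
apply/lee_addgt0Pr => e e0.
have [N /ltW Ne] : exists N, (1 / 2 ^+ N < e / 2 :> R)%R.
  have e20 : (0 < e / 2)%R by rewrite divr_gt0.
  exact: filter_ex (near_infty_natSinv_expn_lt (PosNum e20)).
(* The shift by [N] leaves the limit unchanged and bounds the cost by [m + e] at every index, since
   [2 * 2^-(k + N)] stays below [e]. *)
apply: (@crossing_lsc (fun k => H (k + N)%N)) => [k||x|k].
- exact/Cm.
- by apply: Cm; case: (Clim _ CH).
- have [M _ HM] := nondecreasing_near_bigcup x Hnd.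
  by exists M => // k /= Mk; apply: HM; rewrite /= (leq_trans Mk)// leq_addr.
apply: le_trans (Hle _) _; rewrite leeD2l// lee_fin.
rewrite -ler_pdivlMl// mulrC; apply: le_trans Ne; rewrite div1r -exprVn.
by rewrite ler_wiXn2l// ?leq_addl// invf_le1// ler1n.
Qed.

End crossing_functional.

(** * Tonelli's theorem on rectangles *)

Section iterated_integral.
Context d1 d2 (T1 : measurableType d1) (T2 : measurableType d2) (R : realType).
Context (m1 : {sigma_finite_measure set T1 -> \bar R}).
Context (m2 : {sigma_finite_measure set T2 -> \bar R}).
Local Open Scope ereal_scope.

(** Extending [f] by 0 outside the rectangle reduces this to Tonelli on the whole product. *)
Lemma integral_setX (f : T1 * T2 -> \bar R) A B :
  measurable_fun setT f -> (forall z, 0 <= f z) -> measurable A -> measurable B ->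
  \int[m1]_(x in A) \int[m2]_(y in B) f (x, y) =
  \int[(m1 \x m2)%E]_(z in A `*` B) f z.
Proof.
move=> mf f0 mA mB; have mAB : measurable (A `*` B) by exact: measurableX.
rewrite [RHS]integral_mkcond fubini_tonelli1; last 2 first.
- by apply/(measurable_restrictT _ mAB)/measurable_funTS.
- by move=> z; rewrite patchE; case: ifP.
rewrite integral_mkcond; apply: eq_integral => x _.
rewrite patchE /fubini_F; case: ifPn => [/set_mem Ax|Ax].
  rewrite [LHS]integral_mkcond; apply: eq_integral => y _.
  by rewrite !patchE classical_sets.in_setX /= (mem_set Ax).
by rewrite integral0_eq// => y _; rewrite patchE classical_sets.in_setX (negbTE Ax).
Qed.

End iterated_integral.

(** * Lebesgue measurability of open sets and of the kernel *)

Section lebesgue_measurability.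
Context (R : realType) (n : nat).
Local Notation rV := 'rV[R]_n.
(** This copy of R^n carries the Lebesgue sigma-algebra; [rV] itself carries the Borel one. *)
Local Notation lebT := (caratheodory_type ((@borel_lebesgue_rV R n)^*)%mu).

Lemma measurable_borel_lebesgue (A : set rV) : measurable A -> lebesgue_measurable A.
Proof. exact: caratheodory_measurable_mu_ext. Qed.

Lemma measurable_box (A : 'I_n -> set (measurableTypeR R)) :
  (forall i, measurable (A i)) -> measurable [set v : rV | forall i, A i (v ord0 i)].
Proof.
move=> mA; rewrite (_ : mkset _ =
    \bigcap_(i in [set: 'I_n]) (@rV_coord _ _ n i @^-1` A i)).
  apply: fin_bigcap_measurable => // i _.
  by rewrite -[X in measurable X]setTI; apply: measurable_rV_coord => //; exact: mA.
by apply/seteqP; split => [v Av i _|v Av i]; apply: Av.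
Qed.

(** An open set is the union of the countably many cubes with rational centre and half-side
    [1/(k+1)] that it contains. *)
Lemma open_measurable_rV (U : set rV) : open U -> measurable U.
Proof.
move=> oU.
pose I (p : 'rV[rat]_n * nat) i : set (measurableTypeR R) :=
  `]ratr (p.1 ord0 i) - p.2.+1%:R^-1, ratr (p.1 ord0 i) + p.2.+1%:R^-1[%classic.
pose box p := [set v : rV | forall i, I p i (v ord0 i)].
have mbox p : measurable (box p) by apply: measurable_box => i; exact: measurable_itv.
rewrite (_ : U = \bigcup_p (if `[< box p `<=` U >] then box p else set0)).
  apply: countable_bigcupT_measurable => [|p]; first exact: countableP.
  by case: ifP.
apply/seteqP; split => [v Uv|v [p _]]; last by case: asboolP => // + ?; exact.
have /nbhs_ballP[e /= e0 eU] : nbhs v U by exact: open_nbhs_nbhs.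
(* Both [v] and any other point of the cube are within the half-side of its centre, hence within [e]
   of each other in the sup norm. *)
have [k ke] : exists k : nat, k.+1%:R^-1 < e / 2.
  have e20 : 0 < e / 2 by rewrite divr_gt0.
  exact: filter_ex (near_infty_natSinv_lt (PosNum e20)).
have k0 : 0 < k.+1%:R^-1 :> R by rewrite invr_gt0.
have [r rE] : exists r : R, r = k.+1%:R^-1 by exists k.+1%:R^-1.
rewrite -rE in ke k0.
have /choice[q qv] : forall i, exists q : rat, `|v ord0 i - ratr q| < r.
  move=> i; have : v ord0 i - r < v ord0 i + r by lra.
  move=> /rat_in_itvoo[q]; rewrite in_itv/= => /andP[q1 q2]; exists q.
  by rewrite ltr_norml; lra.
exists (\row_i q i, k) => //; rewrite asboolT.
  by move=> i; have := qv i; rewrite /I/= in_itv/= mxE -rE ltr_norml; lra.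
move=> w /= bw; apply: eU; split => // i j; rewrite (ord1 i) /ball/= ltr_norml.
have := bw j; rewrite /I/= in_itv/= mxE -rE.
by have := qv j; rewrite ltr_norml; lra.
Qed.

Lemma measurable_coord_lebesgue (i : 'I_n) :
  measurable_fun [set: lebT] (fun v : lebT => (v : rV) ord0 i).
Proof.
move=> _ Y mY; rewrite setTI; apply: caratheodory_measurable_mu_ext.
by rewrite -[X in measurable X]setTI; exact: measurable_rV_coord.
Qed.

Lemma measurable_frac_kernel (s : R) :
  measurable_fun [set: lebT * lebT] (fun z => frac_kernel s (z.1 : rV) z.2).
Proof.
pose sqd (i : 'I_n) (z : lebT * lebT) :=
  ((z.1 : rV) ord0 i - (z.2 : rV) ord0 i) ^+ 2.
rewrite (_ : (fun z => _) =
    fun z => Num.sqrt (\sum_(i < n) sqd i z) `^ (- (n%:R + s))); last first.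
  apply/funext => z; rewrite powRN /frac_kernel /euclidean_norm.
  by under eq_bigr do rewrite !mxE.
apply: (measurableT_comp (measurable_powR _)).
apply: (@measurableT_comp _ _ _ _ _ _ (@Num.sqrt R)).
  by apply: continuous_measurable_fun; exact: sqrt_continuous.
apply: (@measurable_sum _ _ R setT _ (index_enum 'I_n) sqd) => i.
apply: measurable_funX; apply: measurable_funB.
  by apply: measurableT_comp (measurable_coord_lebesgue i) _; exact: measurable_fst.
by apply: measurableT_comp (measurable_coord_lebesgue i) _; exact: measurable_snd.
Qed.

End lebesgue_measurability.

(** * The [s]-perimeter as the measure of crossing pairs *)

Section frac_perimeter_crossing.
Context (R : realType) (n : nat) (s : R).
Local Notation rV := 'rV[R]_n.
Local Notation leb := (@lebesgue_rV R n).
Local Notation lebT := (caratheodory_type ((@borel_lebesgue_rV R n)^*)%mu).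
Local Open Scope ereal_scope.

Let K (z : lebT * lebT) : \bar R := (frac_kernel s (z.1 : rV) z.2)%:E.

Let measurable_K : measurable_fun setT K.
Proof. by apply/measurable_EFinP; exact: measurable_frac_kernel. Qed.

Let K_ge0 z : 0 <= K z.
Proof. by rewrite lee_fin invr_ge0 powR_ge0. Qed.

Definition interaction_measure : {measure set (lebT * lebT) -> \bar R} :=
  density_measure (leb \x leb)%E measurable_K K_ge0.

Lemma frac_interactionE (A B : set rV) :
  lebesgue_measurable A -> lebesgue_measurable B ->
  frac_interaction s A B = interaction_measure (A `*` B).
Proof. by move=> mA mB; exact: (integral_setX leb leb measurable_K K_ge0 mA mB). Qed.

Lemma frac_perimeterE (E Omega : set rV) :
  lebesgue_measurable E -> lebesgue_measurable Omega ->
  frac_perimeter s E Omega = interaction_measure (crossing Omega E).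
Proof.
move=> mE mO; have mCE : lebesgue_measurable (~` E) by exact: measurableC.
rewrite measure_crossing// /frac_perimeter !frac_interactionE//;
  (exact: measurableI || exact: measurableD).
Qed.

End frac_perimeter_crossing.

(** * Competitors with prescribed exterior datum *)

Section exterior_datum.
Context d (T : measurableType d) (R : realType) (mu : {measure set T -> \bar R}).
Implicit Types (A B E F Omega : set T).

Lemma ae_iff_trans B A E : {ae mu, forall x, A x <-> B x} ->
  {ae mu, forall x, B x <-> E x} -> {ae mu, forall x, A x <-> E x}.
Proof. by apply: filterS2 => x -> ->. Qed.

Definition agree_outside Omega (E0 : set T) : set (set T) :=
  [set E | measurable E /\ {ae mu, forall x, (E `\` Omega) x <-> (E0 `\` Omega) x}].

Lemma agree_outside_setIU Omega (E0 : set T) E F :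
  agree_outside Omega E0 E -> agree_outside Omega E0 F ->
  agree_outside Omega E0 (E `&` F) /\ agree_outside Omega E0 (E `|` F).
Proof.
move=> [mE EE0] [mF FE0]; split; split.
- exact: measurableI.
- by apply: filterS2 EE0 FE0 => x /=; tauto.
- exact: measurableU.
- by apply: filterS2 EE0 FE0 => x /=; tauto.
Qed.

(** The exceptional null sets are countably many; off their union every [E k] agrees with [E0]
    outside [Omega]. *)
Lemma agree_outside_bigcapcup Omega (E0 : set T) (E : (set T)^nat) :
  (forall k, agree_outside Omega E0 (E k)) ->
  agree_outside Omega E0 (\bigcap_k E k) /\ agree_outside Omega E0 (\bigcup_k E k).
Proof.
move=> /all_and2[mE /ae_foralln EE0]; split; split.
- exact: bigcapT_measurable.
- apply: filterS EE0 => x /= EE0; split => [[Ex Ox]|E0x].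
    by apply/(EE0 0%N); split => //; exact: Ex.
  by split=> [k _|]; [have /(EE0 k)[] := E0x|case: E0x].
- exact: bigcupT_measurable.
- apply: filterS EE0 => x /= EE0; split => [[[k _ Ex] Ox]|E0x].
    exact/(EE0 k).
  by split; [exists 0%N => //; have /(EE0 0%N)[] := E0x|case: E0x].
Qed.

End exterior_datum.

Unset Implicit Arguments.

Theorem corollary1p9 (R : realType) (n : nat) (s : R) (Omega : set 'rV[R]_n) :
  0 < s < 1 ->
  open Omega ->
  (frac_perimeter s Omega setT < +oo)%E ->
  forall E0 : set 'rV[R]_n, lebesgue_measurable E0 ->
  exists E : set 'rV[R]_n,
    [/\ lebesgue_measurable E,
        frac_minimal s Omega E &
        ae_eq_set (E `\` Omega) (E0 `\` Omega)].
Proof.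
move=> _ oO POoo E0 mE0.
have mO : lebesgue_measurable Omega.
  by apply: measurable_borel_lebesgue; exact: open_measurable_rV.
have mT : @lebesgue_measurable R n setT by exact: measurableT.
have mU : lebesgue_measurable (E0 `|` Omega).
  exact: (measurableU _ _ mE0 mO).
have U_oo : (interaction_measure n s (crossing Omega (E0 `|` Omega)) < +oo)%E.
  (* The perimeter of [Omega] in the whole space is the measure of [crossing setT Omega], which
     contains the crossing pairs of the competitor. *)
  move: POoo; rewrite frac_perimeterE//; apply: le_lt_trans.
  apply: le_measure; rewrite ?inE; try exact: measurable_crossing.
  by move=> [x y] /= [/= Ux /not_orP[E0y Oy] O]; split => //=; [case: O|left].
pose C := agree_outside (lebesgue_rV n) Omega E0.
have CU : C (E0 `|` Omega).
  by split => //; apply: aeW => x /=; tauto.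
have [E [mE EE0] [Eoo Emin]] := crossing_minimizer mO (fun E => @proj1 _ _)
  (ex_intro2 _ _ _ CU U_oo) (@agree_outside_setIU _ _ _ (lebesgue_rV n) Omega E0)
  (@agree_outside_bigcapcup _ _ _ (lebesgue_rV n) Omega E0).
exists E; split => //; split; first by rewrite frac_perimeterE.
move=> F mF FE; rewrite !frac_perimeterE//; apply: Emin; split => //.
exact: ae_iff_trans FE EE0.
Qed.
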